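(* Let $n\ge 1$ and let $\mu$ be a distribution with $\mu\{x\le 0\}\le n$ and $\mu\{x>0\}=0$. If a distribution $\nu$ is obtained from $\mu$ by a weight-constrained sequence of moves, then $\nu\{x\ge 6n^{1/3}-1\}=0$.
   Context: A (discrete mass) distribution is a finite set $\mu=\{(x_1,m_1),\dots,(x_k,m_k)\}$ with $x_i\in\mathbb R$ and $m_i>0$; a signed distribution is the same without the positivity requirement. For $A\subseteq\mathbb R$, $\mu(A)=\sum_{x_i\in A}m_i$, and $\mu\{x>a\}$ means $\mu(\{x:x>a\})$, etc. Moments: $M_j[\mu]=\sum_i m_ix_i^j$. A move $v=([a,b],\delta)$ consists of an interval with $b-a=1$ and a signed distribution $\delta$ supported in $[a,b]$ with $M_0[\delta]=M_1[\delta]=0$; its center is $\frac{a+b}2$. It can be applied to $\mu$ if $\mu+\delta$ (pointwise sum of masses) is a distribution, and then $v\mu=\mu+\delta$. A sequence of moves $v_1,\dots,v_\ell$ applied to $\mu_0$ produces $\mu_i=v_i\mu_{i-1}$. For such a sequence, $\mu_{\max}\{x>a\}=\max_{0\le i\le\ell}\mu_i\{x>a\}$ (similarly for $\ge$). The sequence is weight-constrained (with respect to $\mu_0$) if for every $a\in\mathbb R$ the number of moves of the sequence whose center lies in $(a,\infty)$ is at most $\mu_{\max}\{x>a\}$. *)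

(* Defs.v *)
From Stdlib Require Import Reals List.
Import ListNotations.
Open Scope R_scope.

(* A (signed) distribution is represented by a finite list of (point, mass)
   pairs; the measure is the aggregate: masses at equal points add up.
   Concatenation of lists is then exactly the pointwise sum of masses. *)
Definition sdist := list (R * R).

Definition pmass (d : sdist) (x : R) : R :=
  fold_right (fun p acc => (if Req_EM_T (fst p) x then snd p else 0) + acc) 0 d.

(* a (nonnegative) distribution: every point carries nonnegative mass
   (points with zero aggregate mass are simply absent) *)
Definition is_dist (d : sdist) : Prop := forall x, 0 <= pmass d x.

Definition mass_gt (d : sdist) (a : R) : R :=
  fold_right (fun p acc => (if Rlt_dec a (fst p) then snd p else 0) + acc) 0 d.
Definition mass_ge (d : sdist) (a : R) : R :=
  fold_right (fun p acc => (if Rle_dec a (fst p) then snd p else 0) + acc) 0 d.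
Definition mass_le (d : sdist) (a : R) : R :=
  fold_right (fun p acc => (if Rle_dec (fst p) a then snd p else 0) + acc) 0 d.

Definition moment (j : nat) (d : sdist) : R :=
  fold_right (fun p acc => snd p * (fst p) ^ j + acc) 0 d.

Record move := Move { mv_a : R; mv_delta : sdist }.

Definition mv_center (v : move) : R := mv_a v + 1 / 2.

Definition valid_move (v : move) : Prop :=
  Forall (fun p => mv_a v <= fst p <= mv_a v + 1) (mv_delta v) /\
  moment 0 (mv_delta v) = 0 /\ moment 1 (mv_delta v) = 0.

Fixpoint states (mu : sdist) (vs : list move) : list sdist :=
  mu :: match vs with
        | nil => nil
        | v :: vs' => states (mu ++ mv_delta v) vs'
        end.

Fixpoint final (mu : sdist) (vs : list move) : sdist :=
  match vs with
  | nil => mu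
  | v :: vs' => final (mu ++ mv_delta v) vs'
  end.

Definition applicable (mu : sdist) (vs : list move) : Prop :=
  Forall valid_move vs /\ Forall is_dist (states mu vs).

Definition mu_max_gt (mu : sdist) (vs : list move) (a : R) : R :=
  fold_right (fun d acc => Rmax (mass_gt d a) acc) (mass_gt mu a) (states mu vs).

Definition count_centers_gt (vs : list move) (a : R) : nat :=
  length (filter (fun v => if Rlt_dec a (mv_center v) then true else false) vs).

Definition weight_constrained (mu : sdist) (vs : list move) : Prop :=
  forall a : R, INR (count_centers_gt vs a) <= mu_max_gt mu vs a.

(* Main.v *)
Require Import Defs.
From Coquelicot Require Import Coquelicot.
From Stdlib Require Import Reals List Lra Lia.
Open Scope R_scope.

(* Write [F(a)] for the maximal mass beyond [a]. The heart of the matter is that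
   [F(r) <= q^3] implies [F(r + 1 + 5q/2) < (q/2)^3]; iterating from [r = -1] reaches
   some [x < 6q - 3/2] with [F(x) < 1], so no move is centered beyond [x].

   For the contraction put [P = q^3], [rho = r + 1]. The potential
   [H(t) = int (x - t)_+] of a distribution is convex, of slope at least [-P] on
   [[r, oo)], and a move on [[a, b]] changes it only inside [(a, b)], where convexity
   keeps it below its chord. Hence [H] stays below the tail integral of a density [G]
   on [[rho, oo)] which starts at [0] and is averaged over [[a, b]] by each move with
   [b > rho] (with [G] read as [P] to the left of [rho]). Averaging can only increase
   [int (G + 2 k t - P)^2] by the variance [k^2 / 3] of [2 k t] on a unit interval, so
   [int (G^2 - 2 P G + 4 k t G)] is at most [k^2 / 3] times the number of moves centered
   beyond [rho - 1/2], and that number is at most [P] by the weight constraint. On the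
   other hand it is at least [2 k int t G - P^3 / (3 k)], and [int t G >= p d^2 / 2] once
   mass [p] lies beyond [rho + d]. Choose [k = q^2] and [d = 5q/2]. *)

(** * Sums of functions against a distribution *)

Definition isum (f : R -> R) (d : sdist) : R :=
  fold_right (fun p acc => snd p * f (fst p) + acc) 0 d.

Lemma isum_app f d1 d2 : isum f (d1 ++ d2) = isum f d1 + isum f d2.
Proof. induction d1 as [|p d1 IH]; simpl; lra. Qed.

Lemma isum_ext f g d :
  (forall p, In p d -> f (fst p) = g (fst p)) -> isum f d = isum g d.
Proof.
  induction d as [|p d IH]; simpl; intros H; [reflexivity|].
  rewrite (H p) by auto. rewrite IH by (intros; apply H; auto). reflexivity.
Qed.

Lemma isum_linear c f e g d :
  isum (fun x => c * f x + e * g x) d = c * isum f d + e * isum g d.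
Proof. induction d as [|p d IH]; simpl; [|rewrite IH]; ring. Qed.

Lemma isum_extract f d x :
  isum f d = pmass d x * f x
    + isum f (filter (fun p => if Req_EM_T (fst p) x then false else true) d).
Proof.
  induction d as [|p d IH]; simpl; [ring|].
  destruct (Req_EM_T (fst p) x) as [E|E]; simpl; rewrite IH; [rewrite E|]; ring.
Qed.

Lemma is_dist_remove d x :
  is_dist d ->
  is_dist (filter (fun p => if Req_EM_T (fst p) x then false else true) d).
Proof.
  intros Hd y.
  replace (pmass _ y) with (if Req_EM_T x y then 0 else pmass d y).
  { destruct (Req_EM_T x y); [lra | apply Hd]. }
  clear Hd. induction d as [|p d IH]; simpl; [destruct (Req_EM_T x y); reflexivity|].
  destruct (Req_EM_T (fst p) x) as [E|E]; simpl; rewrite <- IH;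
    destruct (Req_EM_T x y); destruct (Req_EM_T (fst p) y);
    try congruence; ring.
Qed.

(** Single entries may carry negative mass; only the aggregate at a point is nonnegative. Hence the
    induction on the length, removing all entries at one point together. *)
Lemma isum_nonneg f d :
  is_dist d -> (forall p, In p d -> 0 <= f (fst p)) -> 0 <= isum f d.
Proof.
  remember (length d) as k eqn:Ek.
  assert (Hk : (length d <= k)%nat) by lia. clear Ek.
  revert d Hk. induction k as [|k IH]; intros d Hk Hd Hf.
  - destruct d; simpl in *; [lra|lia].
  - destruct d as [|p d]; [simpl; lra|].
    rewrite (isum_extract f _ (fst p)).
    apply Rplus_le_le_0_compat.
    + apply Rmult_le_pos; [apply Hd | apply Hf; left; reflexivity].
    + apply IH.
      * simpl. destruct (Req_EM_T (fst p) (fst p)); [|congruence].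
        pose proof (filter_length_le
          (fun p0 => if Req_EM_T (fst p0) (fst p) then false else true) d).
        simpl in Hk. lia.
      * apply is_dist_remove, Hd.
      * intros p0 H0. apply filter_In in H0. apply Hf, H0.
Qed.

Lemma isum_le f g d :
  is_dist d -> (forall p, In p d -> f (fst p) <= g (fst p)) ->
  isum f d <= isum g d.
Proof.
  intros Hd H.
  assert (H1 : 0 <= isum (fun x => 1 * g x + (-1) * f x) d).
  { apply isum_nonneg; [assumption|]. intros p Hp. specialize (H p Hp). lra. }
  rewrite isum_linear in H1. lra.
Qed.

Lemma mass_gt_isum d a :
  mass_gt d a = isum (fun x => if Rlt_dec a x then 1 else 0) d.
Proof.
  induction d as [|p d IH]; simpl; [reflexivity|].
  rewrite IH; destruct (Rlt_dec a (fst p)); ring.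
Qed.

Lemma mass_ge_isum d a :
  mass_ge d a = isum (fun x => if Rle_dec a x then 1 else 0) d.
Proof.
  induction d as [|p d IH]; simpl; [reflexivity|].
  rewrite IH; destruct (Rle_dec a (fst p)); ring.
Qed.

Lemma moment_isum j d : moment j d = isum (fun x => x ^ j) d.
Proof. reflexivity. Qed.

Lemma mass_le_gt d a : mass_le d a + mass_gt d a = moment 0 d.
Proof.
  induction d as [|p d IH]; simpl; [ring|]. rewrite <- IH.
  destruct (Rle_dec (fst p) a), (Rlt_dec a (fst p)); lra.
Qed.

Lemma mass_gt_antitone d a b :
  is_dist d -> a <= b -> mass_gt d b <= mass_gt d a.
Proof.
  intros Hd Hab. rewrite !mass_gt_isum. apply isum_le; [assumption|].
  intros p _. destruct (Rlt_dec b (fst p)), (Rlt_dec a (fst p)); lra.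
Qed.

Lemma mass_gt_le_total d a : is_dist d -> mass_gt d a <= moment 0 d.
Proof.
  intros Hd. rewrite mass_gt_isum, moment_isum. apply isum_le; [assumption|].
  intros p _. simpl. destruct (Rlt_dec a (fst p)); lra.
Qed.

Lemma mass_gt_nonneg d a : is_dist d -> 0 <= mass_gt d a.
Proof.
  intros Hd. rewrite mass_gt_isum. apply isum_nonneg; [assumption|].
  intros p _. destruct (Rlt_dec a (fst p)); lra.
Qed.

(** * The potential of a distribution *)

(* The potential [H_d (t) = int (x - t)_+ dd = int_t^oo d {x > s} ds]:
   a move on [[a, a + 1]] leaves it unchanged outside [(a, a + 1)]. *)
Definition excess (d : sdist) (t : R) : R := isum (fun x => Rmax (x - t) 0) d.

Ltac case_max :=
  repeat match goal with |- context [Rmax ?x ?y] =>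
    destruct (Rle_lt_dec x y);
    [rewrite (Rmax_right x y) by lra | rewrite (Rmax_left x y) by lra] end.

Lemma excess_move_outside mu v t :
  valid_move v -> t <= mv_a v \/ mv_a v + 1 <= t ->
  excess (mu ++ mv_delta v) t = excess mu t.
Proof.
  intros (Hs & H0 & H1) Ht. unfold excess. rewrite isum_app.
  rewrite moment_isum in H0, H1. rewrite Forall_forall in Hs.
  enough (E : isum (fun x => Rmax (x - t) 0) (mv_delta v) = 0) by lra.
  (* On the support of the move [(x - t)_+] is affine in [x], so the two vanishing moments
     annihilate it. *)
  destruct Ht as [Ht|Ht].
  - transitivity (isum (fun x => 1 * x ^ 1 + (- t) * x ^ 0) (mv_delta v)).
    + apply isum_ext. intros p Hp. specialize (Hs p Hp). rewrite Rmax_left; simpl; lra.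
    + rewrite isum_linear. simpl in *. rewrite H0, H1. ring.
  - transitivity (isum (fun x => 0 * x ^ 0 + 0 * x ^ 0) (mv_delta v)).
    + apply isum_ext. intros p Hp. specialize (Hs p Hp). rewrite Rmax_right; simpl; lra.
    + rewrite isum_linear. ring.
Qed.

Lemma excess_convex d a t :
  is_dist d -> a <= t <= a + 1 ->
  excess d t <= (a + 1 - t) * excess d a + (t - a) * excess d (a + 1).
Proof.
  intros Hd Ht. unfold excess. rewrite <- isum_linear. apply isum_le; [assumption|].
  intros p _. simpl. case_max; nra.
Qed.

Lemma excess_slope d a b :
  is_dist d -> a <= b -> excess d a <= excess d b + (b - a) * mass_gt d a.
Proof.
  intros Hd Hab. unfold excess. rewrite mass_gt_isum.
  rewrite <- (Rmult_1_l (isum (fun x => Rmax (x - b) 0) d)), <- isum_linear.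
  apply isum_le; [assumption|].
  intros p _. simpl. destruct (Rlt_dec a (fst p)); case_max; lra.
Qed.

Lemma excess_ge_mass d t u :
  is_dist d -> t <= u -> (u - t) * mass_gt d u <= excess d t.
Proof.
  intros Hd Htu. unfold excess. rewrite mass_gt_isum.
  replace (_ * isum _ d) with
    ((u - t) * isum (fun x => if Rlt_dec u x then 1 else 0) d + 0 * isum (fun x => 0) d) by ring.
  rewrite <- isum_linear. apply isum_le; [assumption|].
  intros p _. simpl. destruct (Rlt_dec u (fst p)); case_max; lra.
Qed.

Lemma support_bounded (d : sdist) : exists X, 0 <= X /\ forall p, In p d -> fst p <= X.
Proof.
  induction d as [|p d (X & HX & H)]; [exists 0; simpl; intuition lra|].
  exists (Rmax X (fst p)).
  pose proof (Rmax_l X (fst p)). pose proof (Rmax_r X (fst p)).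
  split; [lra|]. intros p' [<-|Hp']; [lra|]. specialize (H p' Hp'). lra.
Qed.

(** Entries beyond 0 may exist and cancel, so [(x - t)_+] is compared with [X] times the indicator
    of [x > 0], where [X] bounds the support. *)
Lemma excess_le0 d t :
  is_dist d -> mass_gt d 0 = 0 -> 0 <= t -> excess d t <= 0.
Proof.
  intros Hd H0 Ht. destruct (support_bounded d) as (X & HX & HdX).
  replace 0 with (X * mass_gt d 0 + 0 * mass_gt d 0) by (rewrite H0; ring).
  rewrite mass_gt_isum, <- isum_linear. apply isum_le; [assumption|].
  intros p Hp. specialize (HdX p Hp). simpl.
  destruct (Rlt_dec 0 (fst p)); case_max; lra.
Qed.

Lemma mass_ge_eq0 d a : is_dist d -> mass_gt d 0 = 0 -> 0 < a -> mass_ge d a = 0.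
Proof.
  intros Hd H0 Ha. apply Rle_antisym.
  - rewrite <- H0, mass_ge_isum, mass_gt_isum. apply isum_le; [assumption|].
    intros p _. destruct (Rle_dec a (fst p)), (Rlt_dec 0 (fst p)); lra.
  - rewrite mass_ge_isum. apply isum_nonneg; [assumption|].
    intros p _. destruct (Rle_dec a (fst p)); lra.
Qed.

(** * The states of a sequence of moves and their maximal tail masses *)

Lemma states_head mu vs : In mu (states mu vs).
Proof. destruct vs; left; reflexivity. Qed.

Lemma mu_max_gt_ge mu vs a d : In d (states mu vs) -> mass_gt d a <= mu_max_gt mu vs a.
Proof.
  unfold mu_max_gt. induction (states mu vs) as [|e l IH]; simpl; [tauto|].
  intros [<-|H]; [apply Rmax_l|].
  eapply Rle_trans; [apply IH, H | apply Rmax_r].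
Qed.

Lemma mu_max_gt_attained mu vs a :
  exists d, In d (states mu vs) /\ mu_max_gt mu vs a = mass_gt d a.
Proof.
  assert (H : forall l, exists d, In d (mu :: l) /\
    fold_right (fun d acc => Rmax (mass_gt d a) acc) (mass_gt mu a) l = mass_gt d a).
  { induction l as [|e l (d & Hd & E)]; simpl; [exists mu; auto|].
    rewrite E. destruct (Rle_lt_dec (mass_gt e a) (mass_gt d a)) as [L|L].
    - exists d. rewrite Rmax_right by lra. simpl in Hd. intuition.
    - exists e. rewrite Rmax_left by lra. auto. }
  destruct (H (states mu vs)) as (d & [<-|Hd] & E).
  - exists mu. split; [apply states_head | exact E].
  - exists d. auto.
Qed.

Lemma states_moment0 mu vs d :
  Forall valid_move vs -> In d (states mu vs) -> moment 0 d = moment 0 mu.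
Proof.
  revert mu. induction vs as [|v vs IH]; simpl; intros mu Hv [<-|Hd]; try tauto.
  inversion Hv as [|? ? (_ & H0 & _) Hvs]; subst.
  rewrite (IH _ Hvs Hd). rewrite !moment_isum, isum_app, <- !moment_isum. lra.
Qed.

Lemma mass_ge_final mu vs a :
  Forall valid_move vs -> (forall v, In v vs -> mv_a v + 1 < a) ->
  mass_ge (final mu vs) a = mass_ge mu a.
Proof.
  revert mu. induction vs as [|v vs IH]; simpl; intros mu Hv Ha; [reflexivity|].
  inversion Hv as [|? ? (Hs & _ & _) Hvs]; subst.
  rewrite IH by auto. rewrite !mass_ge_isum, isum_app.
  specialize (Ha v (or_introl eq_refl)). rewrite Forall_forall in Hs.
  replace (isum _ (mv_delta v)) with
    (isum (fun x => 0 * x ^ 0 + 0 * x ^ 0) (mv_delta v)).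
  - rewrite isum_linear. ring.
  - apply isum_ext. intros p Hp. specialize (Hs p Hp).
    destruct (Rle_dec a (fst p)); lra.
Qed.

Lemma count_centers_gt_eq0 vs a :
  INR (count_centers_gt vs a) < 1 -> forall v, In v vs -> mv_center v <= a.
Proof.
  intros H v Hv. destruct (Rle_lt_dec (mv_center v) a) as [L|L]; [exact L|exfalso].
  assert (Hin : In v (filter
    (fun v => if Rlt_dec a (mv_center v) then true else false) vs)).
  { apply filter_In. split; [exact Hv|]. destruct (Rlt_dec a (mv_center v)); [reflexivity|lra]. }
  unfold count_centers_gt in H. destruct (filter _ vs) as [|x l]; [destruct Hin|].
  cbn [length] in H. rewrite S_INR in H. pose proof (pos_INR (length l)). lra.
Qed.

(** * Densities on [[0, B]] and their integrals *)

(* Satisfied by step functions; it yields the integrability of every polynomial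
   expression in [t] and [G t]. *)
Definition steplike (B : R) (G : R -> R) : Prop :=
  forall h : R -> R -> R, (forall s x y, ex_RInt (fun t => h t s) x y) ->
  ex_RInt (fun t => h t (G t)) 0 B.

(** Equals [(g + 2 k t - P)^2 - (2 k t - P)^2]: the square of the overview, normalized to vanish at
    [g = 0]. *)
Definition energy (P k t g : R) : R := g * g - 2 * P * g + 4 * k * t * g.

Definition plateau (a b s : R) (G : R -> R) (t : R) : R :=
  if Rlt_dec a t then if Rlt_dec t b then s else G t else G t.

Lemma ex_RInt_derivable (f : R -> R) x y :
  (forall t, ex_derive f t) -> ex_RInt f x y.
Proof.
  intros H. apply (ex_RInt_continuous (V := R_CompleteNormedModule)).
  intros t _. apply (ex_derive_continuous (V := R_NormedModule)), H.
Qed.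

Ltac integrable := intros; apply ex_RInt_derivable; intros; auto_derive; auto.

Lemma ex_RInt_sub (f : R -> R) B x y :
  ex_RInt f 0 B -> 0 <= x -> x <= y -> y <= B -> ex_RInt f x y.
Proof.
  intros H Hx Hxy Hy.
  apply (ex_RInt_Chasles_2 f 0); [lra|]. apply (ex_RInt_Chasles_1 f 0 y B); [lra|exact H].
Qed.

Lemma steplike_ex_RInt B G (h : R -> R -> R) x y :
  steplike B G -> (forall s x y, ex_RInt (fun t => h t s) x y) ->
  0 <= x -> x <= y -> y <= B -> ex_RInt (fun t => h t (G t)) x y.
Proof. intros HG Hh. apply ex_RInt_sub, HG, Hh. Qed.

Lemma steplike_ex_RInt_id B G x y :
  steplike B G -> 0 <= x -> x <= y -> y <= B -> ex_RInt G x y.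
Proof.
  intros HG. apply (steplike_ex_RInt B G (fun _ s => s)); [exact HG|integrable].
Qed.

Lemma ex_RInt_energy P k s x y : ex_RInt (fun t => energy P k t s) x y.
Proof. unfold energy; integrable. Qed.

Lemma RInt_split B G x y z :
  steplike B G -> 0 <= x -> x <= y -> y <= z -> z <= B ->
  RInt G x z = RInt G x y + RInt G y z :> R.
Proof.
  intros HG Hx Hxy Hyz Hz. symmetry.
  apply (RInt_Chasles (V := R_CompleteNormedModule));
    apply (steplike_ex_RInt_id B); auto; lra.
Qed.

(** * Making a density constant on an interval *)

Section Plateau.

Variables (B a b s : R) (G : R -> R).
Hypotheses (Ha : 0 <= a) (Hab : a <= b) (Hb : b <= B) (HG : steplike B G).

Lemma plateau_in (h : R -> R -> R) t :
  a < t < b -> h t (plateau a b s G t) = h t s.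
Proof.
  intros Ht. unfold plateau.
  destruct (Rlt_dec a t); [|lra]. destruct (Rlt_dec t b); [reflexivity|lra].
Qed.

Lemma plateau_out (h : R -> R -> R) t :
  t <= a \/ b <= t -> h t (plateau a b s G t) = h t (G t).
Proof.
  intros Ht. unfold plateau.
  destruct (Rlt_dec a t); [|reflexivity]. destruct (Rlt_dec t b); [lra|reflexivity].
Qed.

Lemma RInt_plateau_left (h : R -> R -> R) x y :
  x <= y -> y <= a ->
  RInt (fun t => h t (plateau a b s G t)) x y = RInt (fun t => h t (G t)) x y.
Proof.
  intros Hxy Hy. apply RInt_ext. intros t Ht.
  rewrite Rmin_left, Rmax_right in Ht by lra. apply plateau_out. lra.
Qed.

Lemma RInt_plateau_right (h : R -> R -> R) x y :
  x <= y -> b <= x ->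
  RInt (fun t => h t (plateau a b s G t)) x y = RInt (fun t => h t (G t)) x y.
Proof.
  intros Hxy Hy. apply RInt_ext. intros t Ht.
  rewrite Rmin_left, Rmax_right in Ht by lra. apply plateau_out. lra.
Qed.

Lemma RInt_plateau_mid (h : R -> R -> R) x y :
  a <= x -> x <= y -> y <= b ->
  RInt (fun t => h t (plateau a b s G t)) x y = RInt (fun t => h t s) x y.
Proof.
  intros Hx Hxy Hy. apply RInt_ext. intros t Ht.
  rewrite Rmin_left, Rmax_right in Ht by lra. apply plateau_in. lra.
Qed.

Lemma steplike_plateau : steplike B (plateau a b s G).
Proof.
  intros h Hh. apply (ex_RInt_Chasles _ 0 a).
  { apply (ex_RInt_ext (fun t => h t (G t))).
    - intros t Ht. rewrite Rmin_left, Rmax_right in Ht by lra.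
      symmetry; apply plateau_out; lra.
    - apply (steplike_ex_RInt B); auto; lra. }
  apply (ex_RInt_Chasles _ a b).
  { apply (ex_RInt_ext (fun t => h t s)); [|apply Hh].
    intros t Ht. rewrite Rmin_left, Rmax_right in Ht by lra.
    symmetry; apply plateau_in; lra. }
  apply (ex_RInt_ext (fun t => h t (G t))).
  - intros t Ht. rewrite Rmin_left, Rmax_right in Ht by lra.
    symmetry; apply plateau_out; lra.
  - apply (steplike_ex_RInt B); auto; lra.
Qed.

Lemma RInt_split3 (f : R -> R) :
  ex_RInt f 0 B -> RInt f 0 B = RInt f 0 a + RInt f a b + RInt f b B.
Proof.
  intros Hf.
  rewrite <- (RInt_Chasles f 0 b B), <- (RInt_Chasles f 0 a b); [reflexivity|..];
    apply (ex_RInt_sub f B); auto; lra.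
Qed.

Lemma RInt_plateau_total (h : R -> R -> R) :
  (forall s x y, ex_RInt (fun t => h t s) x y) ->
  RInt (fun t => h t (plateau a b s G t)) 0 B
    = RInt (fun t => h t (G t)) 0 B
      + (RInt (fun t => h t s) a b - RInt (fun t => h t (G t)) a b) :> R.
Proof.
  intros Hh.
  rewrite (RInt_split3 (fun t => h t (plateau a b s G t))) by (apply steplike_plateau; auto).
  rewrite (RInt_split3 (fun t => h t (G t))) by auto.
  rewrite RInt_plateau_left, RInt_plateau_mid, RInt_plateau_right by lra. ring.
Qed.

End Plateau.

(** * Growth of the energy under one move *)

Lemma is_RInt_square c x y :
  is_RInt (fun t => (t - c) ^ 2) x y (((y - c) ^ 3 - (x - c) ^ 3) / 3).
Proof.
  replace (((y - c) ^ 3 - (x - c) ^ 3) / 3)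
    with (minus ((y - c) ^ 3 / 3) ((x - c) ^ 3 / 3))
    by (unfold minus, plus, opp; simpl; field).
  apply (is_RInt_derive (fun t => (t - c) ^ 3 / 3)).
  - intros t _. auto_derive; [auto|]. field.
  - intros t _. apply (ex_derive_continuous (fun t => (t - c) ^ 2)). auto_derive; auto.
Qed.

(* With [e = s - g], completing the square in
   [energy P k t s - energy P k t g = - e^2 + 4 k t e - 2 (P - s) e]
   around an arbitrary abscissa [c]. *)
Lemma energy_diff_le P k c s t g :
  energy P k t s <=
  energy P k t g + (4 * k ^ 2 * (t - c) ^ 2 + (4 * k * c - 2 * (P - s)) * (s - g)).
Proof.
  unfold energy. pose proof (pow2_ge_0 (s - g - 2 * k * (t - c))). nra.
Qed.

(** As [c] is fixed, the coefficient of [s - G t] in [energy_diff_le] is constant in [t], so the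
    error involves [G] only through its integral. *)
Lemma RInt_energy_plateau_le B G P k c s a b :
  steplike B G -> 0 <= a -> a <= b -> b <= B ->
  RInt (fun t => energy P k t s) a b <=
  RInt (fun t => energy P k t (G t)) a b
  + (4 * k ^ 2 * (((b - c) ^ 3 - (a - c) ^ 3) / 3)
     + (4 * k * c - 2 * (P - s)) * (s * (b - a) - RInt G a b)).
Proof.
  intros HG Ha Hab Hb.
  apply (is_RInt_le (fun t => energy P k t s)
    (fun t => energy P k t (G t) + (4 * k ^ 2 * (t - c) ^ 2
              + (4 * k * c - 2 * (P - s)) * (s - G t))) a b); [exact Hab|..].
  - apply (RInt_correct (V := R_CompleteNormedModule)), ex_RInt_energy.
  - apply (is_RInt_plus (V := R_NormedModule)).
    + apply (RInt_correct (V := R_CompleteNormedModule)).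
      apply (steplike_ex_RInt B); auto. intros; apply ex_RInt_energy.
    + apply (is_RInt_plus (V := R_NormedModule)).
      * apply (is_RInt_scal (V := R_NormedModule)), is_RInt_square.
      * apply (is_RInt_scal (V := R_NormedModule)).
        apply (is_RInt_minus (V := R_NormedModule)).
        -- replace (s * (b - a)) with (scal (b - a) s) by (unfold scal; simpl; unfold mult; simpl; ring).
           apply (is_RInt_const (V := R_NormedModule)).
        -- apply (RInt_correct (V := R_CompleteNormedModule)).
           apply (steplike_ex_RInt_id B); auto.
  - intros t _. apply energy_diff_le.
Qed.

(* [a] is the left end of the move, [Rmax a 0] the left end of the plateau. For
   [a < 0] the density is extended by the constant [P] on [(a, 0)]. *)
Lemma energy_step B G P k a :
  steplike B G -> 0 < k -> -1 <= a -> a + 1 <= B ->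
  let al := Rmax a 0 in
  let s := P * (al - a) + RInt G al (a + 1) in
  RInt (fun t => energy P k t (plateau al (a + 1) s G t)) 0 B
    <= RInt (fun t => energy P k t (G t)) 0 B + k ^ 2 / 3.
Proof.
  intros HG Hk Ha Hb al s.
  assert (Hal : 0 <= al /\ al <= a + 1 /\ a <= al).
  { unfold al. case_max; lra. }
  rewrite (RInt_plateau_total B al (a + 1) s G) by (try lra; auto; intros; apply ex_RInt_energy).
  (* The midpoint of the move minimizes the integral of [(t - c)^2] over the whole move; it is
     truncated at the origin. *)
  set (c := Rmax (a + 1 / 2) 0).
  pose proof (RInt_energy_plateau_le B G P k c s al (a + 1) HG) as H.
  specialize (H ltac:(lra) ltac:(lra) ltac:(lra)).
  set (w := al - a) in *.
  replace (s * (a + 1 - al) - RInt G al (a + 1)) with (w * (P - s)) in H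
    by (unfold s, w; ring).
  (* With [y = P - s], completing the square gives [(4 k c y - 2 y^2) w <= 2 k^2 c^2 w]. What
     remains is this inequality, an equality when [a >= 0]. *)
  assert (Hc : 4 * (((a + 1 - c) ^ 3 - (al - c) ^ 3) / 3) + 2 * c ^ 2 * w <= 1 / 3).
  { unfold w, al, c. case_max; try nra. }
  assert (Hw : 0 <= w) by (unfold w; lra).
  pose proof (Rmult_le_pos _ _ Hw (pow2_ge_0 (P - s - k * c))).
  pose proof (Rmult_le_compat_l (k ^ 2) _ _ (pow2_ge_0 k) Hc).
  nra.
Qed.

(** * Densities dominating the potential *)

(** The variable [u] is measured from [rho], and [B] stands for infinity: it will be chosen so that
    no move reaches beyond [rho + B]. *)
Definition dominates (B rho : R) (G : R -> R) (d : sdist) : Prop :=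
  forall u, 0 <= u <= B -> excess d (rho + u) <= RInt G u B.

Lemma RInt_constant (s x y : R) : RInt (fun _ => s) x y = s * (y - x) :> R.
Proof. rewrite RInt_const. unfold scal; simpl; unfold mult; simpl. ring. Qed.

(** On [[al, a + 1]] the tail integral of the plateau is affine with slope [-s], so the chord of the
    potential need only be compared with this line at the two ends of the move. *)
Lemma dominates_step B rho P G mu v :
  steplike B G -> valid_move v ->
  is_dist mu -> is_dist (mu ++ mv_delta v) ->
  mass_gt mu (rho - 1) <= P -> dominates B rho G mu ->
  let a := mv_a v - rho in
  -1 <= a -> a + 1 <= B ->
  let al := Rmax a 0 in
  let s := P * (al - a) + RInt G al (a + 1) in
  dominates B rho (plateau al (a + 1) s G) (mu ++ mv_delta v).
Proof.
  intros HG Hv Hmu Hmu' HP Hdom a Ha Hb al s u Hu.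
  assert (Hal : 0 <= al /\ al <= a + 1 /\ a <= al).
  { unfold al. case_max; lra. }
  set (G' := plateau al (a + 1) s G).
  assert (HG' : steplike B G') by (apply steplike_plateau; auto; lra).
  assert (Hright : forall x, a + 1 <= x <= B -> RInt G' x B = RInt G x B :> R).
  { intros x Hx. apply (RInt_plateau_right al (a + 1) s G (fun _ g => g)); lra. }
  assert (Hmid : forall x, al <= x <= a + 1 -> RInt G' x (a + 1) = s * (a + 1 - x) :> R).
  { intros x Hx. rewrite <- RInt_constant.
    apply (RInt_plateau_mid al (a + 1) s G (fun _ g => g)); lra. }
  destruct (Rle_lt_dec (a + 1) u) as [H1|H1].
  { rewrite excess_move_outside by (auto; unfold a in *; lra).
    rewrite Hright by lra. apply Hdom, Hu. }
  rewrite (RInt_split B G' u (a + 1) B), Hright by (auto; lra).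
  destruct (Rle_lt_dec al u) as [H2|H2].
  - rewrite Hmid by lra.
    eapply Rle_trans; [apply (excess_convex _ (mv_a v)); [exact Hmu' | unfold a in *; lra]|].
    rewrite !excess_move_outside by (auto; lra).
    replace (mv_a v) with (rho + a) by (unfold a; ring).
    pose proof (Hdom al ltac:(lra)) as D1.
    pose proof (Hdom (a + 1) ltac:(lra)) as D2.
    pose proof (excess_slope mu (rho + a) (rho + al) Hmu ltac:(lra)) as D3.
    pose proof (mass_gt_antitone mu (rho - 1) (rho + a) Hmu ltac:(lra)) as D4.
    rewrite (RInt_split B G al (a + 1) B) in D1 by (auto; lra).
    replace (rho + a + 1) with (rho + (a + 1)) by ring.
    (* The left end of the move may lie left of [rho], out of reach of the domination; the slope
       bound [P] covers the gap. *)
    assert (D5 : excess mu (rho + a) <= s + RInt G (a + 1) B).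
    { unfold s. pose proof (Rmult_le_compat_l (al - a) _ _ ltac:(lra) (Rle_trans _ _ _ D4 HP)).
      lra. }
    pose proof (Rmult_le_compat_l (a + 1 - u) _ _ ltac:(lra) D5).
    pose proof (Rmult_le_compat_l (u - a) _ _ ltac:(lra) D2).
    replace (rho + a + 1 - (rho + u)) with (a + 1 - u) by ring.
    replace (rho + u - (rho + a)) with (u - a) by ring. lra.
  (* Here [0 <= u < al], so the whole move lies right of [rho] and [s] is a true mean: the plateau
     leaves the tail integral at [u] unchanged. *)
  - assert (Eal : al = a) by (revert H2; unfold al; case_max; lra).
    rewrite excess_move_outside by (auto; unfold a in *; lra).
    rewrite (RInt_split B G' u al (a + 1)) by (auto; lra).
    rewrite Hmid by lra.
    replace (RInt G' u al) with (RInt G u al)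
      by (symmetry; apply (RInt_plateau_left al (a + 1) s G (fun _ g => g)); lra).
    assert (Es : s * (a + 1 - al) = RInt G al (a + 1)) by (unfold s; rewrite Eal; ring).
    rewrite Es.
    pose proof (Hdom u Hu) as D.
    rewrite (RInt_split B G u al B), (RInt_split B G al (a + 1) B) in D by (auto; lra).
    lra.
Qed.

(* Moves with [mv_a v + 1 <= rho] do not change the excess on [[rho, oo)]. *)
Lemma dominating_density B rho P k vs : forall mu G,
  0 <= P -> 0 < k ->
  Forall valid_move vs -> Forall is_dist (states mu vs) ->
  (forall v, In v vs -> mv_a v - rho + 1 <= B) ->
  (forall d, In d (states mu vs) -> mass_gt d (rho - 1) <= P) ->
  steplike B G -> (forall t, 0 <= G t) -> dominates B rho G mu ->
  forall d, In d (states mu vs) ->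
  exists G', steplike B G' /\ (forall t, 0 <= G' t) /\ dominates B rho G' d /\
    RInt (fun t => energy P k t (G' t)) 0 B <=
    RInt (fun t => energy P k t (G t)) 0 B
      + k ^ 2 / 3 * INR (count_centers_gt vs (rho - 1 / 2)).
Proof.
  induction vs as [|v vs IH]; intros mu G HP Hk Hv Hd HB Hm HG HG0 Hdom d Hin.
  - destruct Hin as [<-|[]]. exists G. repeat split; auto. simpl. lra.
  - cbn [states] in *.
    inversion Hv as [|? ? Hv1 Hvs]; subst. inversion Hd as [|? ? Hd1 Hds]; subst.
    pose proof (pos_INR (count_centers_gt (v :: vs) (rho - 1 / 2))) as Hc0.
    pose proof (pow2_ge_0 k) as Hk2.
    destruct Hin as [<-|Hin].
    { exists G. repeat split; auto. nra. }
    assert (Hd2 : is_dist (mu ++ mv_delta v))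
      by (rewrite Forall_forall in Hds; apply Hds, states_head).
    set (a := mv_a v - rho).
    assert (HaB : a + 1 <= B) by (apply HB; left; reflexivity).
    (* The move reaches beyond [rho] exactly when its center exceeds [rho - 1 / 2], that is, when it
       is counted. *)
    destruct (Rlt_dec (-1) a) as [L|L].
    + set (al := Rmax a 0).
      set (s := P * (al - a) + RInt G al (a + 1)).
      assert (Hal : 0 <= al /\ al <= a + 1 /\ a <= al) by (unfold al; case_max; lra).
      assert (Hs : 0 <= s).
      { unfold s. apply Rplus_le_le_0_compat; [apply Rmult_le_pos; lra|].
        apply RInt_ge_0; [lra| |auto]. apply (steplike_ex_RInt_id B); auto; lra. }
      destruct (IH (mu ++ mv_delta v) (plateau al (a + 1) s G)) with (d := d)
        as (G' & H1 & H2 & H3 & H4); auto.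
      * intros v' Hv'. apply HB. right. exact Hv'.
      * intros d' Hd'. apply Hm. right. exact Hd'.
      * apply steplike_plateau; auto; lra.
      * intros t. unfold plateau. destruct (Rlt_dec al t); auto. destruct (Rlt_dec t (a + 1)); auto.
      * apply (dominates_step B rho P G mu v); auto; [|fold a; lra].
        apply Hm. left. reflexivity.
      * exists G'. repeat split; auto.
        pose proof (energy_step B G P k a HG Hk ltac:(lra) HaB) as E.
        cbv zeta in E. fold al in E. fold s in E.
        replace (count_centers_gt (v :: vs) (rho - 1 / 2))
          with (S (count_centers_gt vs (rho - 1 / 2))).
        -- rewrite S_INR. lra.
        -- unfold count_centers_gt. simpl.
           destruct (Rlt_dec (rho - 1 / 2) (mv_center v)) as [C|C]; [reflexivity|].
           unfold mv_center in C. unfold a in L. lra.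
    + destruct (IH (mu ++ mv_delta v) G) with (d := d)
        as (G' & H1 & H2 & H3 & H4); auto.
      * intros v' Hv'. apply HB. right. exact Hv'.
      * intros d' Hd'. apply Hm. right. exact Hd'.
      * intros u Hu. rewrite excess_move_outside by (auto; unfold a in L; lra). auto.
      * exists G'. repeat split; auto.
        replace (count_centers_gt (v :: vs) (rho - 1 / 2))
          with (count_centers_gt vs (rho - 1 / 2)); [exact H4|].
        unfold count_centers_gt. simpl.
        destruct (Rlt_dec (rho - 1 / 2) (mv_center v)) as [C|C]; [|reflexivity].
        unfold mv_center in C. unfold a in L. lra.
Qed.

(** * Lower bounds for the first moment and the energy *)

(** Over [N] equal steps the defects add up to [c d^2 / N], which tends to 0. This replaces a
    derivative argument, since [f] will involve integrals of a discontinuous density. *)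
Lemma monotone_of_quadratic_defect (f : R -> R) c d :
  0 <= d -> (forall u v, 0 <= u -> u <= v -> v <= d -> f u - c * (v - u) ^ 2 <= f v) ->
  f 0 <= f d.
Proof.
  intros Hd H.
  assert (Hc : forall N k : nat, (k <= S N)%nat ->
    f 0 - INR k * (c * (d / INR (S N)) ^ 2) <= f (INR k * (d / INR (S N)))).
  { intros N k. pose proof (lt_0_INR (S N) ltac:(lia)) as HN.
    set (e := d / INR (S N)).
    assert (He : 0 <= e) by (unfold e; apply Rdiv_le_0_compat; lra).
    assert (Ee : INR (S N) * e = d) by (unfold e; field; lra).
    induction k as [|k IH]; intros Hk.
    - simpl. rewrite !Rmult_0_l. lra.
    - specialize (IH ltac:(lia)).
      apply le_INR, (Rmult_le_compat_r e _ _ He) in Hk. pose proof (pos_INR k).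
      specialize (H (INR k * e) (INR (S k) * e)).
      rewrite Ee in Hk. rewrite (S_INR k) in *.
      specialize (H ltac:(nra) ltac:(nra) Hk).
      replace ((INR k + 1) * e - INR k * e) with e in H by ring. lra. }
  destruct (Rle_lt_dec (f 0) (f d)) as [L|L]; [exact L|exfalso].
  (* [N] is taken so large that the total defect [c d^2 / (N + 1)] falls below [f 0 - f d]. *)
  destruct (INR_unbounded (c * d ^ 2 / (f 0 - f d))) as [N HN].
  specialize (Hc N (S N) (le_n _)).
  pose proof (lt_0_INR (S N) ltac:(lia)) as HN0.
  replace (INR (S N) * (d / INR (S N))) with d in Hc by (field; lra).
  replace (INR (S N) * (c * (d / INR (S N)) ^ 2)) with (c * d ^ 2 / INR (S N)) in Hc
    by (field; lra).
  assert (HN1 : c * d ^ 2 / (f 0 - f d) < INR (S N)) by (rewrite S_INR; lra).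
  apply (Rmult_lt_compat_r (f 0 - f d)) in HN1; [|lra].
  replace (c * d ^ 2 / (f 0 - f d) * (f 0 - f d)) with (c * d ^ 2) in HN1 by (field; lra).
  apply (Rmult_lt_compat_r (/ INR (S N))) in HN1; [|apply Rinv_0_lt_compat; lra].
  replace (INR (S N) * (f 0 - f d) * / INR (S N)) with (f 0 - f d) in HN1 by (field; lra).
  unfold Rdiv in Hc. lra.
Qed.

(* [int_0^v t G + v int_v^B G] is [int_0^v K] for the tail integral [K] of [G]. *)
Lemma first_moment_ge B G p d :
  steplike B G -> (forall t, 0 <= G t) -> 0 <= p -> 0 <= d <= B ->
  (forall u, 0 <= u <= d -> p * (d - u) <= RInt G u B) ->
  p * d ^ 2 / 2 <= RInt (fun t => t * G t) 0 B.
Proof.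
  intros HG HG0 Hp Hd HK.
  assert (HtG : forall x y, 0 <= x -> x <= y -> y <= B -> ex_RInt (fun t => t * G t) x y).
  { intros. apply (steplike_ex_RInt B G (fun t g => t * g)); auto. integrable. }
  assert (Hlow : forall x y, 0 <= x -> x <= y -> y <= B ->
    x * RInt G x y <= RInt (fun t => t * G t) x y).
  { intros x y Hx Hxy Hy.
    replace (x * RInt G x y) with (RInt (fun t => x * G t) x y).
    - apply RInt_le; auto.
      + apply (ex_RInt_scal (V := R_NormedModule)), (steplike_ex_RInt_id B); auto.
      + intros t Ht. apply Rmult_le_compat_r; [apply HG0|lra].
    - apply (RInt_scal (V := R_CompleteNormedModule)), (steplike_ex_RInt_id B); auto. }
  assert (Hsplit : forall x y z, 0 <= x -> x <= y -> y <= z -> z <= B ->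
    RInt (fun t => t * G t) x z = RInt (fun t => t * G t) x y + RInt (fun t => t * G t) y z :> R).
  { intros x y z Hx Hxy Hyz Hz. symmetry.
    apply (RInt_Chasles (V := R_CompleteNormedModule)); apply HtG; lra. }
  (* Integration by parts makes [A v] the integral over [[0, v]] of [K(u) - p (d - u)], which is
     nonnegative by [HK]. *)
  pose (A := fun v => RInt (fun t => t * G t) 0 v + v * RInt G v B - p * (d * v - v ^ 2 / 2)).
  assert (HA : A 0 <= A d).
  { apply (monotone_of_quadratic_defect A (p / 2)); [lra|].
    intros u v Hu Huv Hvd. unfold A.
    rewrite (Hsplit 0 u v) by lra.
    rewrite (RInt_split B G u v B) by (auto; lra).
    pose proof (Hlow u v Hu Huv ltac:(lra)).
    pose proof (Rmult_le_compat_l (v - u) _ _ ltac:(lra) (HK v ltac:(lra))).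
    nra. }
  unfold A in HA. rewrite RInt_point in HA. unfold zero in HA; simpl in HA.
  rewrite (Hsplit 0 d B) by lra.
  pose proof (Hlow d B ltac:(lra) ltac:(lra) ltac:(lra)). nra.
Qed.

(** Half of the term [4 k t g] is kept. With [T = P / k] the rest is [g^2 - 2 k (T - t) g], at least
    [- k^2 (T - t)^2] for [t <= T] and nonnegative beyond [T]. *)
Lemma RInt_energy_ge B G P k :
  steplike B G -> (forall t, 0 <= G t) -> 0 < k -> 0 <= P -> P / k <= B ->
  2 * k * RInt (fun t => t * G t) 0 B - P ^ 3 / (3 * k)
    <= RInt (fun t => energy P k t (G t)) 0 B.
Proof.
  intros HG HG0 Hk HP HB. set (T := P / k) in *.
  assert (ET : P = k * T) by (unfold T; field; lra).
  assert (HT : 0 <= T) by (unfold T; apply Rdiv_le_0_compat; lra).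
  assert (HtG : forall x y, 0 <= x -> x <= y -> y <= B -> ex_RInt (fun t => t * G t) x y).
  { intros. apply (steplike_ex_RInt B G (fun t g => t * g)); auto. integrable. }
  assert (HE : forall x y, 0 <= x -> x <= y -> y <= B ->
    ex_RInt (fun t => energy P k t (G t)) x y).
  { intros. apply (steplike_ex_RInt B G (energy P k)); auto. intros; apply ex_RInt_energy. }
  rewrite <- (RInt_Chasles (fun t => energy P k t (G t)) 0 T B) by (apply HE; lra).
  rewrite <- (RInt_Chasles (fun t => t * G t) 0 T B) by (apply HtG; lra).
  assert (H1 : 2 * k * RInt (fun t => t * G t) 0 T + - k ^ 2 * (((T - T) ^ 3 - (0 - T) ^ 3) / 3)
    <= RInt (fun t => energy P k t (G t)) 0 T).
  { apply (is_RInt_le (fun t => 2 * k * (t * G t) + - k ^ 2 * (t - T) ^ 2)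
      (fun t => energy P k t (G t)) 0 T); [lra|..].
    - apply (is_RInt_plus (V := R_NormedModule)).
      + apply (is_RInt_scal (V := R_NormedModule)).
        apply (RInt_correct (V := R_CompleteNormedModule)), HtG; lra.
      + apply (is_RInt_scal (V := R_NormedModule)), is_RInt_square.
    - apply (RInt_correct (V := R_CompleteNormedModule)), HE; lra.
    - intros t _. unfold energy. rewrite ET.
      pose proof (pow2_ge_0 (G t - k * T + k * t)). nra. }
  assert (H2 : 2 * k * RInt (fun t => t * G t) T B
    <= RInt (fun t => energy P k t (G t)) T B).
  { apply (is_RInt_le (fun t => 2 * k * (t * G t))
      (fun t => energy P k t (G t)) T B); [lra|..].
    - apply (is_RInt_scal (V := R_NormedModule)).
      apply (RInt_correct (V := R_CompleteNormedModule)), HtG; lra.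
    - apply (RInt_correct (V := R_CompleteNormedModule)), HE; lra.
    - intros t Ht. unfold energy. rewrite ET. pose proof (HG0 t) as Hg.
      assert (0 <= k * (t - T) * G t) by (apply Rmult_le_pos; [apply Rmult_le_pos|]; lra).
      nra. }
  replace (P ^ 3 / (3 * k)) with (k ^ 2 * T ^ 3 / 3) by (rewrite ET; field; lra).
  unfold plus; simpl. simpl in H1, H2. lra.
Qed.

(** * Contraction of the tail mass and its iteration *)

Lemma moves_bounded (vs : list move) c :
  exists B, c <= B /\ forall v, In v vs -> mv_a v <= B.
Proof.
  induction vs as [|v vs (B & Hc & H)]; [exists c; simpl; intuition lra|].
  exists (Rmax B (mv_a v)).
  pose proof (Rmax_l B (mv_a v)). pose proof (Rmax_r B (mv_a v)).
  split; [lra|]. intros v' [<-|Hv']; [lra|]. specialize (H v' Hv'). lra.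
Qed.

Lemma tail_mass_bound mu vs r P k d e :
  -1 <= r -> 0 <= P -> 0 < k -> 0 <= d ->
  mass_gt mu 0 = 0 -> applicable mu vs ->
  (forall e, In e (states mu vs) -> mass_gt e r <= P) ->
  In e (states mu vs) ->
  k * (mass_gt e (r + 1 + d) * d ^ 2)
    <= P ^ 3 / (3 * k) + k ^ 2 / 3 * INR (count_centers_gt vs (r + 1 / 2)).
Proof.
  intros Hr HP Hk Hd H0 [Hv Hs] Hm He.
  pose proof Hs as Hs'. rewrite Forall_forall in Hs'.
  destruct (moves_bounded vs (Rmax (P / k) d + Rabs r)) as (B0 & HB0 & HB).
  pose proof (Rmax_l (P / k) d). pose proof (Rmax_r (P / k) d).
  pose proof (Rle_abs r). pose proof (Rle_abs (- r)) as Hr'. rewrite Rabs_Ropp in Hr'.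
  set (B := B0 - r).
  assert (Hz : RInt (fun t => energy P k t 0) 0 B = 0 :> R).
  { rewrite (RInt_ext _ (fun _ => 0)); [rewrite RInt_constant; ring|].
    intros t _. change (energy P k t 0 = 0). unfold energy. ring. }
  (* The zero density dominates the start, which has no mass beyond 0 while [0 <= r + 1]. *)
  destruct (dominating_density B (r + 1) P k vs mu (fun _ => 0)) with (d := e)
    as (G & HG & HG0 & Hdom & HE); auto.
  - intros v Hin. specialize (HB v Hin). unfold B. lra.
  - intros d' Hd'. replace (r + 1 - 1) with r by ring. auto.
  - intros h Hh. apply Hh.
  - intros; lra.
  - intros u Hu. rewrite RInt_constant, Rmult_0_l.
    apply excess_le0; [apply Hs', states_head | exact H0 | lra].
  - rewrite Hz in HE.
    replace (r + 1 - 1 / 2) with (r + 1 / 2) in HE by field.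
    pose proof (RInt_energy_ge B G P k HG HG0 Hk HP ltac:(unfold B; lra)) as HL.
    assert (HF : mass_gt e (r + 1 + d) * d ^ 2 / 2 <= RInt (fun t => t * G t) 0 B).
    { apply first_moment_ge; auto; [apply mass_gt_nonneg; auto | unfold B; lra |].
      intros u Hu. eapply Rle_trans; [|apply Hdom; unfold B; lra].
      pose proof (excess_ge_mass e (r + 1 + u) (r + 1 + d) (Hs' e He) ltac:(lra)). lra. }
    apply (Rmult_le_compat_l (2 * k)) in HF; [|lra]. lra.
Qed.

Lemma tail_mass_contraction mu vs r q :
  -1 <= r -> 0 < q -> mass_gt mu 0 = 0 -> applicable mu vs -> weight_constrained mu vs ->
  mu_max_gt mu vs r <= q ^ 3 ->
  mu_max_gt mu vs (r + (1 + 5 / 2 * q)) < (q / 2) ^ 3.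
Proof.
  intros Hr Hq H0 Happ Hw Hm.
  destruct (mu_max_gt_attained mu vs (r + (1 + 5 / 2 * q))) as (e & He & ->).
  destruct (mu_max_gt_attained mu vs (r + 1 / 2)) as (f & Hf & Ef).
  assert (Hc : INR (count_centers_gt vs (r + 1 / 2)) <= q ^ 3).
  { eapply Rle_trans; [apply Hw|]. rewrite Ef.
    eapply Rle_trans; [apply (mass_gt_antitone f r); [|lra]|].
    - destruct Happ as [_ Hs]. rewrite Forall_forall in Hs. auto.
    - eapply Rle_trans; [apply mu_max_gt_ge, Hf | exact Hm]. }
  pose proof (pow_lt q 2 Hq) as Hq2. pose proof (pow_lt q 3 Hq) as Hq3.
  pose proof (pow_lt q 4 Hq) as Hq4.
  pose proof (tail_mass_bound mu vs r (q ^ 3) (q ^ 2) (5 / 2 * q) e Hr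
    ltac:(lra) Hq2 ltac:(lra) H0 Happ) as H.
  specialize (H (fun e He => Rle_trans _ _ _ (mu_max_gt_ge mu vs r e He) Hm) He).
  rewrite Rplus_assoc in H.
  set (p := mass_gt e (r + (1 + 5 / 2 * q))) in *.
  replace ((q ^ 3) ^ 3 / (3 * q ^ 2)) with (q ^ 4 * (q ^ 3 / 3)) in H by (field; lra).
  pose proof (Rmult_le_compat_l ((q ^ 2) ^ 2 / 3) _ _ ltac:(nra) Hc).
  (* Both error terms are at most [q^7 / 3], whence [p <= 8/75 q^3], less than [q^3 / 8]. *)
  assert (Hp : q ^ 4 * (25 / 4 * p) <= q ^ 4 * (2 / 3 * q ^ 3)) by nra.
  apply Rmult_le_reg_l in Hp; [|exact Hq4]. nra.
Qed.

(** Each round halves [q] and advances by [1 + 5q/2], while the budget [6 q] drops by [3 q]; the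
    surplus [q / 2] pays for the 1 when [q > 2]. For [q <= 2] one round suffices. [k] bounds the
    number of halvings. *)
Lemma tail_mass_lt_1 mu vs (k : nat) :
  mass_gt mu 0 = 0 -> applicable mu vs -> weight_constrained mu vs ->
  forall r q, -1 <= r -> 1 <= q <= 2 ^ S k -> mu_max_gt mu vs r <= q ^ 3 ->
  exists x, x < r + 6 * q - 1 / 2 /\ mu_max_gt mu vs x < 1.
Proof.
  intros H0 Happ Hw. induction k as [|k IH]; intros r q Hr Hq Hm;
    pose proof (tail_mass_contraction mu vs r q Hr ltac:(lra) H0 Happ Hw Hm) as Hc.
  - exists (r + (1 + 5 / 2 * q)). split; [lra|].
    eapply Rlt_le_trans; [exact Hc|]. rewrite <- (pow1 3). apply pow_incr. simpl in Hq. lra.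
  - destruct (Rle_lt_dec q 2) as [L|L].
    + exists (r + (1 + 5 / 2 * q)). split; [lra|].
      eapply Rlt_le_trans; [exact Hc|]. rewrite <- (pow1 3). apply pow_incr. lra.
    + destruct (IH (r + (1 + 5 / 2 * q)) (q / 2)) as (x & Hx & Hx1); [lra| |lra|].
      * change (2 ^ S (S k)) with (2 * 2 ^ S k) in Hq. lra.
      * exists x. split; [lra|exact Hx1].
Qed.

Theorem mainTheorem2 (n : R) (mu : sdist) (vs : list move) :
  1 <= n ->
  is_dist mu ->
  mass_le mu 0 <= n ->
  mass_gt mu 0 = 0 ->
  applicable mu vs ->
  weight_constrained mu vs ->
  mass_ge (final mu vs) (6 * Rpower n (1 / 3) - 1) = 0.
Proof.
  intros Hn Hmu Hle H0 Happ Hw.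
  set (q := Rpower n (1 / 3)).
  assert (Hq3 : q ^ 3 = n).
  { unfold q. rewrite <- Rpower_pow, Rpower_mult by apply exp_pos.
    replace (1 / 3 * INR 3) with 1 by (simpl; field). apply Rpower_1. lra. }
  assert (Hq : 1 <= q).
  { unfold q. rewrite <- (Rpower_O n) at 1 by lra. apply Rle_Rpower; lra. }
  (* At [r = -1] the point [r + 1] is 0, and the conserved total mass is at most [n]. *)
  assert (Hstart : mu_max_gt mu vs (-1) <= q ^ 3).
  { destruct (mu_max_gt_attained mu vs (-1)) as (e & He & ->).
    destruct Happ as [Hv Hs]. rewrite Forall_forall in Hs.
    eapply Rle_trans; [apply mass_gt_le_total; auto|].
    rewrite (states_moment0 mu vs e Hv He), <- (mass_le_gt mu 0). lra. }
  destruct (Pow_x_infinity 2 ltac:(rewrite Rabs_pos_eq; lra) q) as [N HN].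
  specialize (HN (S N) ltac:(lia)). rewrite Rabs_pos_eq in HN by (apply pow_le; lra).
  destruct (tail_mass_lt_1 mu vs N H0 Happ Hw (-1) q) as (x & Hx & Hx1); [lra..|exact Hstart|].
  (* A move centered at most at [x < 6 q - 3/2] ends before [6 q - 1]. *)
  rewrite mass_ge_final; [apply mass_ge_eq0; auto; lra | apply Happ |].
  intros v Hin.
  pose proof (count_centers_gt_eq0 vs x (Rle_lt_trans _ _ _ (Hw x) Hx1) v Hin) as Hc.
  unfold mv_center in Hc. lra.
Qed.
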